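(* Let $n\geq 2$ be an integer and let $(a_1,a_2,\ldots,a_n)\in(0,\infty)^n$. If $$0<a_1\leq a_2\leq\cdots\leq a_n\quad\text{and}\quad a_1^{a_n}\geq e^{-1},$$ then $$\mathrm{C}(a_1,a_2,\ldots,a_n)\geq \mathrm{C}^{*}(a_1,a_2,\ldots,a_n),$$ that is, $$\sum_{i=1}^{n-1}a_i^{a_{i+1}}+a_n^{a_1}\;\geq\;\sum_{i=1}^{n}a_i^{a_{n+1-i}}.$$ Moreover, equality holds if $n=2$ or $a_1=a_2=\cdots=a_n$.
   Context: For an integer $n\ge 2$ and $(a_1,\ldots,a_n)\in(0,\infty)^n$, the Cater cyclic function is $\mathrm{C}(a_1,\ldots,a_n)=\sum_{i=1}^{n}a_i^{a_{i+1}}$ with indices taken modulo $n$ (so $a_{n+1}=a_1$), i.e. $\mathrm{C}(a_1,\ldots,a_n)=\sum_{i=1}^{n-1}a_i^{a_{i+1}}+a_n^{a_1}$. The function $\mathrm{C}^{*}$ is $\mathrm{C}^{*}(a_1,\ldots,a_n)=\sum_{i=1}^{n}a_i^{a_{n+1-i}}$. Powers are real powers of positive reals. *)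

(* Defs.v *)
From mathcomp Require Import all_boot all_order all_algebra.
From mathcomp Require Import reals sequences exp.
Set Implicit Arguments. Unset Strict Implicit. Unset Printing Implicit Defensive.
Import Order.TTheory GRing.Theory Num.Theory.
Local Open Scope ring_scope.

(* A point (a_1, ..., a_n) is a function a : 'I_n -> R, with a_(i+1) = a i. *)

Definition first_idx (n : nat) (hn : (2 <= n)%N) : 'I_n := Ordinal (ltnW hn).

Definition last_idx (n : nat) (hn : (2 <= n)%N) : 'I_n := rev_ord (first_idx hn).

(* ordS is the cyclic successor, so ordS (last_idx hn) = first_idx hn. *)
Definition Cater (R : realType) (n : nat) (a : 'I_n -> R) : R :=
  \sum_(i < n) a i `^ a (ordS i).

(* rev_ord sends i to n - 1 - i, which is i |-> n + 1 - i on 1-based indices. *)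
Definition Cater_star (R : realType) (n : nat) (a : 'I_n -> R) : R :=
  \sum_(i < n) a i `^ a (rev_ord i).

(* Main.v *)
(** On the square [[a_1, a_n]^2] the mixed derivative of [x^y] is
    [x^(y-1) * (1 + y ln x)], which is nonnegative since [a_1^a_n >= e^-1];
    so [x^y] is supermodular there.  By the rearrangement inequality for
    supermodular kernels, the order-reversing permutation minimises
    [sum_i a_i^(a_(s i))] over all permutations [s], in particular it does
    not exceed the value at the cyclic shift. *)
Require Import Defs.
From mathcomp Require Import all_boot all_order all_algebra.
From mathcomp Require Import reals sequences exp.
From mathcomp Require Import normedtype derive.
From mathcomp Require Import ring lra zify.
Set Implicit Arguments. Unset Strict Implicit. Unset Printing Implicit Defensive.
Import Order.TTheory GRing.Theory Num.Theory.
Import numFieldNormedType.Exports.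
Local Open Scope ring_scope.

Section Rearrangement.
Context {d1 d2 : Order.disp_t} {T1 : porderType d1} {T2 : orderType d2}.
Context {R : realDomainType}.

Definition supermodular (K : T1 -> T2 -> R) : Prop :=
  forall x x' y y', (x <= x')%O -> (y <= y')%O ->
    K x y' + K x' y <= K x y + K x' y'.

Lemma supermodular_rearrangement (K : T1 -> T2 -> R) (xs : seq T1) (ys zs : seq T2) :
  supermodular K -> sorted <=%O xs -> sorted >=%O ys ->
  size xs = size ys -> perm_eq ys zs ->
  \sum_(p <- zip xs ys) K p.1 p.2 <= \sum_(p <- zip xs zs) K p.1 p.2.
Proof.
move=> Ksup; elim: xs ys zs => [|x xs IH] [|y ys] zs //=.
  by move=> _ _ _ _; rewrite big_nil; case: zs => //=; rewrite big_nil.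
move=> xxs yys [szxs] yszs.
have xs_ge := order_path_min le_trans xxs.
have ys_le := order_path_min ge_trans yys.
have {xxs}xs_sorted := path_sorted xxs.
have {yys}ys_sorted := path_sorted yys.
have yzs : y \in zs by rewrite -(perm_mem yszs) mem_head.
case: zs yszs yzs => [//|z zs] yszs.
rewrite inE; case: eqVneq => [eyz _|nyz /= yzs].
  rewrite -eyz in yszs *; rewrite perm_cons in yszs.
  by rewrite /= !big_cons lerD2l IH.
have szzs : size xs = size zs.
  by move: (perm_size yszs) => /= [<-].
case/splitPr: {zs} yzs yszs szzs => l1 l2 yszs szzs.
(* Exchanging the maximum [y] with the head [z] of [zs] does not increase the
   sum, by supermodularity, and the induction hypothesis handles the tails. *)
have yszs' : perm_eq ys (l1 ++ z :: l2).
  rewrite -(perm_cons y) (perm_trans yszs)//.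
  by apply/permP => P; rewrite /= !count_cat /=; lia.
have zy : (z <= y)%O.
  by apply: (allP ys_le); rewrite (perm_mem yszs') mem_cat mem_head orbT.
have IHyz := IH _ _ xs_sorted ys_sorted szxs yszs'.
rewrite big_cons /=; apply: (le_trans (lerD (lexx _) IHyz)).
(* Cutting [xs] at the position of [y] exposes its partner [x']; the exchange concerns only the
   pairs of [x] and [x'] with [y] and [z]. *)
rewrite -(cat_take_drop (size l1) xs) in szzs xs_ge *.
have szt : size (take (size l1) xs) = size l1.
  by rewrite size_takel// szxs (perm_size yszs') size_cat leq_addr.
case: (drop _ xs) szzs xs_ge => [|x' xs'].
  by rewrite cats0 size_cat szt /= => /eqP; rewrite -{1}(addn0 (size l1)) eqn_add2l.
rewrite all_cat /= => _ /and3P[_ xx' _].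
rewrite !zip_cat//= big_cons !big_cat /= !big_cons /=.
by have := Ksup _ _ _ _ xx' zy; lra.
Qed.

End Rearrangement.

(** An injective self-map of ['I_n] is a permutation, so both sums pair the increasing enumeration
    of ['I_n] with rearrangements of it, the reversed one being nonincreasing. *)
Lemma supermodular_sum_rev_ord (R : realDomainType) (n : nat)
    (K : 'I_n -> 'I_n -> R) (s : 'I_n -> 'I_n) :
  supermodular K -> injective s ->
  \sum_(i < n) K i (rev_ord i) <= \sum_(i < n) K i (s i).
Proof.
move=> Ksup sI.
have zipE (f : 'I_n -> 'I_n) : \sum_(i < n) K i (f i) =
    \sum_(p <- zip (enum 'I_n) (map f (enum 'I_n))) K p.1 p.2.
  by rewrite -{1}(map_id (enum 'I_n)) zip_map big_map big_enum.
have perm_map_enum (f : 'I_n -> 'I_n) :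
    injective f -> perm_eq (map f (enum 'I_n)) (enum 'I_n).
  move=> fI; apply: uniq_perm => [||i].
  - by rewrite (map_inj_uniq fI); exact: enum_uniq.
  - exact: enum_uniq.
  - by rewrite mem_enum -(f_invF fI i) map_f ?mem_enum.
have enum_sorted : sorted <=%O (enum 'I_n).
  by have := iota_sorted 0 n; rewrite -val_enum_ord sorted_map.
rewrite !zipE; apply: supermodular_rearrangement => //.
- rewrite sorted_map; apply: sub_sorted enum_sorted => i j /=.
  by rewrite !leEord /= => ij; apply: leq_sub2l.
- exact: esym (size_map _ _).
- rewrite (perm_trans (perm_map_enum _ rev_ord_inj))// perm_sym.
  exact: perm_map_enum.
Qed.

Section PowerKernel.
Context {R : realType}.
Implicit Types p q t u v x y : R.

(** The derivative [(1 + u) * expR u] is nonnegative from [-1] on; the proof needs only the tangent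
    bound for [expR]. *)
Lemma mul_expR_homo u v : -1 <= u -> u <= v -> u * expR u <= v * expR v.
Proof.
move=> u1 uv.
have [v0|v0] := leP 0 v.
  have [u0|u0] := leP 0 u; first by rewrite ler_pM ?expR_ge0 ?ler_expR.
  apply: (@le_trans _ _ 0); first by rewrite nmulr_rle0 ?expR_ge0.
  by rewrite mulr_ge0 ?expR_ge0.
have -> : u * expR u = u * expR (u - v) * expR v by rewrite -mulrA -expRD subrK.
rewrite ler_wpM2r ?expR_ge0//.
(* As [u < 0], the tangent bound gives [u * expR (u - v) <= u * (1 + u - v) = v + (u - v) * (1 + u)
   <= v]. *)
have := expR_ge1Dx (u - v); nra.
Qed.

(** This is supermodularity of the power in logarithmic form, with [p] and [q] the logarithms of the
    two bases. *)
Lemma expR_mul_sub_homo p q y y' : 0 <= y -> y <= y' -> p <= q -> -1 <= y' * p ->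
  expR (y * q) - expR (y * p) <= expR (y' * q) - expR (y' * p).
Proof.
move=> y0 yy' pq y'p.
pose f t := expR (t * q) - expR (t * p).
have fE t : is_derive t 1 f (q * expR (t * q) - p * expR (t * p)).
  by rewrite /f; apply: is_derive_eq; rewrite /GRing.scale /=; ring.
have df t : derivable f t 1 by exact: ex_derive.
apply: (@ger0_derive1_ndecr R f y y') => //; last first.
  by apply: derivable_within_continuous => t _.
move=> t; rewrite in_itv /= => /andP[yt ty'].
have t0 : 0 < t by exact: le_lt_trans yt.
(* [t * f^`() t] is the increment of [u |-> u * expR u] from [t * p] to [t * q]. *)
rewrite derive1E derive_val -(pmulr_rge0 _ t0) mulrBr !mulrA subr_ge0.
(* The bound [-1 <= t * p] follows from [t < y'] when [p < 0], and is clear when [0 <= p]. *)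
apply: mul_expR_homo; nra.
Qed.

Lemma powR_supermodular x x' y y' : 0 < x -> 0 <= y -> x <= x' -> y <= y' ->
  expR (-1) <= x `^ y' -> x `^ y' + x' `^ y <= x `^ y + x' `^ y'.
Proof.
move=> x0 y0 xx' yy'.
have x'0 : 0 < x' by exact: lt_le_trans xx'.
rewrite /powR !gt_eqF// ler_expR => xy'.
have lnxx' : ln x <= ln x' by rewrite ler_ln.
have := expR_mul_sub_homo y0 yy' lnxx' xy'.
lra.
Qed.

End PowerKernel.

Theorem theorem1p1 (R : realType) (n : nat) (hn : (2 <= n)%N) (a : 'I_n -> R)
    (a_gt0 : forall i : 'I_n, 0 < a i)
    (a_mono : forall i j : 'I_n, (i <= j)%N -> a i <= a j)
    (a_exp : expR (-1) <= a (first_idx hn) `^ a (last_idx hn)) :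
  Cater_star a <= Cater a /\
  (n = 2%N \/ (forall i j : 'I_n, a i = a j) -> Cater a = Cater_star a).
Proof.
split=> [|[n2|a_const]].
- apply: (@supermodular_sum_rev_ord R n (fun i j => a i `^ a j)); last first.
    exact: ordS_inj.
  move=> i i' j j'; rewrite !leEord => ii' jj'.
  apply: powR_supermodular; rewrite ?a_gt0 ?(ltW (a_gt0 _)) ?a_mono//.
  (* The bound at the least base and greatest exponent passes to [a i] and [a j']: if
     [ln (a i) < 0], raising the base or lowering the exponent only increases the product
     [a j' * ln (a i)]; otherwise that product is nonnegative. *)
  move: a_exp; rewrite /powR !gt_eqF// !ler_expR.
  have ai : a (first_idx hn) <= a i by exact: a_mono.
  have aj : a j' <= a (last_idx hn).
    by apply: a_mono; rewrite /= subn1 -ltnS (ltn_predK (ltn_ord j')).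
  have lnai : ln (a (first_idx hn)) <= ln (a i) by rewrite ler_ln ?posrE.
  have [li0 _|li0 hl] := leP 0 (ln (a i)).
    by rewrite (le_trans (lerN10 R)) ?mulr_ge0 ?(ltW (a_gt0 _)).
  apply: (le_trans hl); have := a_gt0 j'; nra.
(* On two indices the cyclic successor and the reversal are the same swap. *)
- subst n; apply: eq_bigr => i _; congr (_ `^ a _).
  by apply/val_inj; case: i => [[|[|]]].
- by apply: eq_bigr => i _; rewrite (a_const (ordS i) (rev_ord i)).
Qed.
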